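(* Let $\{M(t)\}_{t\ge 0}$ be a generalized counting process with positive rates $\lambda_1,\dots,\lambda_k$, put $\Lambda=\lambda_1+\cdots+\lambda_k$, and let $b\ge 0$. The probability law $p(y,t)$ (a generalized density in $y$) of the drifted process $\{M(t)+bt\}_{t>0}$ is given by $$p(y,t)=\sum_{n=0}^{\infty}\ \sum_{\Omega(k,n)}\Big(\prod_{j=1}^{k}\frac{(\lambda_j t)^{x_j}}{x_j!}\Big)e^{-\Lambda t}\,\delta(y-n-bt),\qquad y\ge bt,$$ where $\delta(\cdot)$ is the Dirac delta function. It solves the differential equation $$\Big(\frac{\partial}{\partial t}+b\frac{\partial}{\partial y}\Big)p(y,t)=-\Lambda\, p(y,t)+\sum_{j=1}^{k}\lambda_j\, p(y-j,t)$$ with initial condition $p(y,0)=\delta(y)$ and boundary condition $p(0,t)=\delta(bt)e^{-\Lambda t}$.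
   Context: Generalized counting process (GCP): for $k\ge1$ and $\lambda_1,\dots,\lambda_k>0$, it is the non-negative integer valued Lévy process $\{M(t)\}_{t\ge0}$, $M(0)=0$, with transition probabilities $\Pr\{M(t+h)=n+j\mid M(t)=n\}=1-\Lambda h+o(h)$ for $j=0$, $=\lambda_j h+o(h)$ for $1\le j\le k$, and $=o(h)$ for $j\ge k+1$, as $h\to0$, where $\Lambda=\lambda_1+\cdots+\lambda_k$. Equivalently, $\mathbb{E}(u^{M(t)})=\exp\big(-t\sum_{j=1}^k\lambda_j(1-u^j)\big)$ for $|u|\le1$. $\Omega(k,n)=\{(x_1,\dots,x_k)\in\mathbb{N}_0^k:\ \sum_{j=1}^k jx_j=n\}$, where $\mathbb{N}_0$ is the set of non-negative integers; sums over $\Omega(k,n)$ run over all such tuples. $p(\cdot,t)$ is a generalized function: the statement that it is the law of $M(t)+bt$ means that this random variable has distribution $p(y,t)\,\mathrm{d}y$, i.e. $\mathbb{E}(e^{-s(M(t)+bt)})=\int_0^\infty e^{-sy}p(y,t)\,\mathrm{d}y$ for $s>0$. The differential equation is understood in the sense of generalized functions, $p(\cdot,t)$ being zero to the left of $bt$. The boundary value $p(0,t)$ is the formal (generalized function) value obtained by putting $y=0$. *)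

(* Defs.v *)
From HB Require Import structures.
From mathcomp Require Import all_boot all_order all_algebra.
From mathcomp Require Import all_classical all_reals all_analysis.
From mathcomp Require Import measurable_realfun.

Set Implicit Arguments.
Unset Strict Implicit.
Unset Printing Implicit Defensive.
Import Order.TTheory GRing.Theory Num.Theory.
Import numFieldNormedType.Exports.

Local Open Scope classical_set_scope.
Local Open Scope ring_scope.

Section Processes.
Context (d : measure_display) (T : measurableType d) (R : realType).
Variable P : probability T R.

(* Only meaningful when [P B] is nonzero. *)
Definition cond_prob (A B : set T) : R := fine (P (A `&` B)) / fine (P B).

Definition increment (X : R -> T -> R) (s t : R) : T -> R :=
  fun w => X t w - X s w.

(* Finite partitions [t 0 <= ... <= t n] are given as initial segments of
   nondecreasing sequences. *)
Definition independent_increments (X : R -> T -> R) : Prop :=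
  forall (n : nat) (t : nat -> R) (B : nat -> set R),
    0 <= t 0%N -> (forall i j, (i <= j)%N -> t i <= t j) ->
    (forall i, measurable (B i)) ->
    P (\bigcap_(i < n) (increment X (t i) (t i.+1) @^-1` B i)) =
    (\prod_(i < n) P (increment X (t i) (t i.+1) @^-1` B i))%E.

Definition stationary_increments (X : R -> T -> R) : Prop :=
  forall (s t : R) (B : set R), 0 <= s -> s <= t -> measurable B ->
    P (increment X s t @^-1` B) = P (X (t - s) @^-1` B).

Definition stochastically_continuous (X : R -> T -> R) : Prop :=
  forall t e : R, 0 <= t -> 0 < e ->
    P [set w | e < `|X s w - X t w|] @[s --> within [set s | 0 <= s] (nbhs t)]
      --> 0%E.

(* The time set is [0, +oo[: values of [X] at negative times play no role. *)
Definition levy_process (X : R -> T -> R) : Prop :=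
  [/\ {ae P, forall w, X 0 w = 0},
      independent_increments X,
      stationary_increments X &
      stochastically_continuous X].

Definition total_rate (k : nat) (lam : 'I_k -> R) : R := \sum_(j < k) lam j.

(* The rate of jumps of size [j] is [lam i] for the ordinal [i] of value
   [j - 1]. *)
Definition generalized_counting_process (k : nat) (lam : 'I_k -> R)
    (M : R -> {RV P >-> nat}) : Prop :=
  levy_process (fun t w => (M t w)%:R) /\
  forall (t : R) (n : nat), 0 <= t -> P [set w | M t w = n] != 0%E ->
    let trans (j : nat) (h : R) : R :=
      cond_prob [set w | M (t + h) w = (n + j)%N] [set w | M t w = n] in
    [/\ (fun h => trans 0%N h - (1 - total_rate lam * h)) =o_ (0^'+) id,
        forall i : 'I_k, (fun h => trans i.+1 h - lam i * h) =o_ (0^'+) id &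
        forall j : nat, (k < j)%N -> trans j =o_ (0^'+) id].

Definition drifted (M : R -> {RV P >-> nat}) (b t : R) : T -> R :=
  fun w => (M t w)%:R + b * t.

Lemma measurable_drifted (M : R -> {RV P >-> nat}) (b t : R) :
  measurable_fun setT (drifted M b t).
Proof.
apply: measurable_funD; last exact: measurable_cst.
exact: (@measurableT_comp _ _ _ _ _ _ (fun n : nat => n%:R : R)).
Qed.

HB.instance Definition _ M b t :=
  isMeasurableFun.Build _ _ _ _ (drifted M b t) (measurable_drifted M b t).

End Processes.

(* An entry of a solution of [\sum_j j * x_j = n] is at most [n], so the
   solutions in N^k all have their entries in ['I_n.+1]. *)
Definition Omega (k n : nat) : {set {ffun 'I_k -> 'I_n.+1}} :=
  [set x : {ffun 'I_k -> 'I_n.+1} | (\sum_(j < k) j.+1 * x j)%N == n].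

Section GeneralizedFunctions.
Context (R : realType).

(* A generalized density [p(y) dy] on the line is a set function, with
   [delta(y - a) dy] being the Dirac measure [\d_a].  For [t < 0] the
   coefficients below may be negative. *)
Definition gcp_law (k : nat) (lam : 'I_k -> R) (b t : R) (A : set R) : \bar R :=
  (\sum_(0 <= n <oo) \sum_(x in Omega k n)
     ((\prod_(j < k) ((lam j * t) ^+ x j / (x j)`!%:R))
        * expR (- (total_rate lam * t)))%:E * \d_(n%:R + b * t)%R A)%E.

Definition test_function (phi : R -> R) : Prop :=
  (forall (n : nat) (x : R), derivable (derive1n n phi) x 1) /\
  (exists2 K : set R, compact K & forall x, ~ K x -> phi x = 0).

(* Generalized functions of [y], through their pairing with test functions. *)
Definition gfun : Type := (R -> R) -> R.

Definition gf_of (mu : set R -> \bar R) : gfun :=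
  fun phi => fine (\int[mu]_y (phi y)%:E)%E.

Definition gf_dy (u : gfun) : gfun := fun phi => - u (derive1 phi).

(* [u(y - a)] *)
Definition gf_shift (a : R) (u : gfun) : gfun :=
  fun phi => u (fun y => phi (y + a)).

Definition gf_dt (U : R -> gfun) (t : R) : gfun :=
  fun phi => derive1 (fun s => U s phi) t.

Definition gf_t_differentiable (U : R -> gfun) (t : R) : Prop :=
  forall phi, test_function phi -> derivable (fun s => U s phi) t 1.

(* The generalized function [U t] is defined on the whole line; the equation
   is required for all test functions on the line. *)
Definition solves_drifted_gcp_equation (k : nat) (lam : 'I_k -> R) (b : R)
    (U : R -> gfun) : Prop :=
  forall t, 0 < t -> gf_t_differentiable U t /\
    forall phi, test_function phi ->
      gf_dt U t phi + b * gf_dy (U t) phi =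
      - total_rate lam * U t phi
      + \sum_(j < k) lam j * gf_shift j.+1%:R (U t) phi.

(* Regularizing kernels [eta (x / e) / e]; [eta] is even, as is [delta]. *)
Definition mollifier (eta : R -> R) : Prop :=
  [/\ test_function eta, forall x, eta (- x) = eta x &
      (\int[lebesgue_measure]_x (eta x)%:E = 1)%E].

(* Value at [y] of the convolution of [u] with the regularized delta. *)
Definition regularize (eta : R -> R) (e : R) (u : gfun) (y : R) : R :=
  u (fun z => e^-1 * eta ((y - z) / e)).

(* [p(0,t) = delta(b t) exp(- Lambda t)].  Point values of generalized
   functions are compared by replacing every delta, on both sides, by the same
   regularized delta, and asking for equality as soon as the regularization
   parameter is small enough, uniformly in [t]. *)
Definition boundary_value (L b : R) (U : R -> gfun) : Prop :=
  forall eta, mollifier eta -> \forall e \near 0^'+,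
    forall t, 0 <= t ->
      regularize eta e (U t) 0 =
      regularize eta e (gf_of \d_(0 : R)) (b * t) * expR (- (L * t)).

End GeneralizedFunctions.

(* Main.v *)
(** Independence and stationarity of the increments make the probabilities
    [p_n t = P (M t = n)] a convolution semigroup,
    [p_n (s + h) = \sum_(m <= n) p_m s * p_(n - m) h], and the transition rates
    at time 0 give its generator.  Hence
    [p_n' = - Lambda p_n + \sum_j lambda_j p_(n - j)] on [t > 0], a triangular
    system solved uniquely from [p_n 0 = [n = 0]] by induction on [n].  The sums
    over [Omega k n] solve the same system: differentiating a monomial removes
    one unit from one [x_j].  Tested against a function vanishing to the right
    of [N], the generalized density is a sum of [N] terms, so the equation, the
    initial condition and the boundary condition become statements about finite
    sums; in the boundary condition only [n = 0] survives regularization. *)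

Require Import Defs.
From mathcomp Require Import all_boot all_order all_algebra.
From mathcomp Require Import all_classical all_reals all_analysis.
From mathcomp Require Import measurable_realfun.
From mathcomp Require Import ring lra zify.
Import Order.TTheory GRing.Theory Num.Theory.
Import numFieldNormedType.Exports.
Local Open Scope classical_set_scope.
Local Open Scope ring_scope.

Set Implicit Arguments.
Unset Strict Implicit.
Unset Printing Implicit Defensive.

(** * The polynomials summed over [Omega k n] and their differential equations *)

Section Coefficients.
Context {R : realType} {k : nat} (lam : 'I_k -> R).

Definition weight (f : 'I_k -> nat) : R :=
  \prod_(j < k) (lam j ^+ f j / (f j)`!%:R).

(** The powers of [t] are gathered into one, so that differentiation in [t] touches a single
    factor. *)
Definition monom (f : 'I_k -> nat) (t : R) : R :=
  weight f * t ^+ (\sum_(j < k) f j)%N.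

Lemma monomE (f : 'I_k -> nat) t :
  \prod_(j < k) ((lam j * t) ^+ f j / (f j)`!%:R) = monom f t.
Proof.
rewrite /monom /weight expr_sum -big_split /=; apply: eq_bigr => j _.
by rewrite exprMn mulrAC.
Qed.

(* The entries are bounded by an [N] independent of [n], so that unlike in
   [Omega k n] subtracting a unit vector does not change the type. *)
Definition solutions (N n : nat) : {set {ffun 'I_k -> 'I_N.+1}} :=
  [set x : {ffun 'I_k -> 'I_N.+1} | (\sum_(j < k) j.+1 * x j)%N == n].

Lemma solutions_le N n (x : {ffun 'I_k -> 'I_N.+1}) (i : 'I_k) :
  x \in solutions N n -> (x i <= n)%N.
Proof.
rewrite inE => /eqP <-; rewrite (bigD1 i)//=.
by rewrite (leq_trans _ (leq_addr _ _))// leq_pmull.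
Qed.

(** A solution has entries at most [n], so enlarging the bound to [N] adds none. [G] reads a tuple
    as a function into [nat], which frees the summand from the bound. *)
Lemma sum_solutions N n (G : ('I_k -> nat) -> R) : (n <= N)%N ->
  \sum_(x in solutions N n) G (fun j => x j) =
  \sum_(x in Omega k n) G (fun j => x j).
Proof.
move=> nN; have nN' : (n.+1 <= N.+1)%N by [].
rewrite (reindex_onto (fun x : {ffun 'I_k -> 'I_n.+1} =>
    [ffun j => widen_ord nN' (x j)])
  (fun y : {ffun 'I_k -> 'I_N.+1} => [ffun j => inord (y j)])) /=; last first.
  move=> y yn; apply/ffunP => j; rewrite !ffunE; apply/val_inj => /=.
  by rewrite inordK// ltnS (solutions_le j yn).
apply: eq_big => [x|x _].
  rewrite !inE.
  have -> : [ffun j => inord ([ffun j0 => widen_ord nN' (x j0)] j)] == x.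
    by apply/eqP/ffunP => j; rewrite !ffunE /= inord_val.
  by rewrite andbT; congr (_ == _); apply: eq_bigr => j _; rewrite ffunE.
by congr G; apply/funext => j; rewrite ffunE.
Qed.

Definition unit_shift (f : 'I_k -> nat) (i : 'I_k) : 'I_k -> nat :=
  fun j => (f j + (j == i))%N.

(** Used with [g j = j.+1], where the constraint rises by [i.+1], and with [g = 1], where the degree
    rises by one. *)
Lemma sum_unit_shift (f : 'I_k -> nat) (i : 'I_k) (g : 'I_k -> nat) :
  (\sum_(j < k) g j * unit_shift f i j = \sum_(j < k) g j * f j + g i)%N.
Proof.
under eq_bigr do rewrite mulnDr; rewrite big_split /=; congr addn.
rewrite (bigD1 i)//= eqxx muln1 big1 ?addn0// => j /negPf ->.
by rewrite muln0.
Qed.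

Lemma weight_unit_shift (f : 'I_k -> nat) (i : 'I_k) :
  (f i).+1%:R * weight (unit_shift f i) = lam i * weight f.
Proof.
rewrite /weight (bigD1 i)//= [in RHS](bigD1 i)//= /unit_shift eqxx addn1.
rewrite (eq_bigr (fun j => lam j ^+ f j / (f j)`!%:R)); last first.
  by move=> j /negPf ->; rewrite addn0.
rewrite !mulrA; congr (_ * _).
rewrite factS natrM exprS.
have h1 : (f i).+1%:R != 0 :> R by rewrite pnatr_eq0.
have h2 : (f i)`!%:R != 0 :> R by rewrite pnatr_eq0 -lt0n fact_gt0.
by move: _.+1%:R _`!%:R h1 h2 => a c a0 c0; field; rewrite a0 c0.
Qed.

Definition gcp_poly (n : nat) (t : R) : R :=
  \sum_(x in Omega k n) monom (fun j => x j) t.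

(** Adding a unit to entry [i] is a bijection from the solutions for [n] onto those for [i.+1 + n]
    with nonzero entry [i]. The others are killed by the factor [x i], which [weight_unit_shift]
    turns into [lam i]. *)
Lemma sum_solutions_shift N n (i : 'I_k) t : (i.+1 + n <= N)%N ->
  \sum_(x in solutions N (i.+1 + n)) (x i)%:R *
    (weight (fun j => x j) * t ^+ (\sum_(j < k) x j)%N.-1) =
  lam i * \sum_(x in solutions N n) monom (fun j => x j) t.
Proof.
move=> nN; rewrite (bigID (fun x : {ffun 'I_k -> 'I_N.+1} => x i == 0%N :>
  nat)) /=.
rewrite big1 ?add0r; last by move=> x /andP[_ /eqP ->]; rewrite mul0r.
pose up (x : {ffun 'I_k -> 'I_N.+1}) : {ffun 'I_k -> 'I_N.+1} :=
  [ffun j => inord (unit_shift (fun j => x j) i j)].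
pose down (x : {ffun 'I_k -> 'I_N.+1}) : {ffun 'I_k -> 'I_N.+1} :=
  [ffun j => inord (x j - (j == i))%N].
have upE (x : {ffun 'I_k -> 'I_N.+1}) : (x i < N)%N ->
    (fun j => up x j : nat) = unit_shift (fun j => x j) i.
  move=> xN; apply/funext => j; rewrite ffunE inordK// /unit_shift.
  by case: eqP => [->|_]; rewrite ?addn1 ?ltnS// addn0 -ltnS.
(* [inord] sends the overflow [N.+1] to 0, so [up] is faithful only for [x i < N]; a nonzero entry
   that [down] brings back to [x i] excludes the overflow. *)
have upN x : up x i != 0%N :> nat -> down (up x) = x -> (x i < N)%N.
  move=> x0 /ffunP/(_ i)/(congr1 val); rewrite ffunE eqxx /= inordK.
    by have := ltn_ord (up x i); move: (up x i : nat) (x i : nat) x0; lia.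
  by rewrite (leq_trans _ (ltn_ord (up x i))) ?ltnS ?leq_subr.
rewrite (reindex_onto up down) /=; last first.
  move=> x /andP[_ x0]; apply/ffunP => j; apply/val_inj.
  have -> : up (down x) j = inord (unit_shift (fun j => x j - (j == i))%N i j)
    :> 'I_N.+1.
    rewrite ffunE; congr inord; rewrite /unit_shift ffunE inordK//.
    by rewrite (leq_trans _ (ltn_ord (x j)))// ltnS leq_subr.
  rewrite /= inordK /unit_shift subnK//.
    by case: eqP => [->|]; rewrite // lt0n.
  by case: eqP => [->|]; rewrite // lt0n.
rewrite mulr_sumr; apply: eq_big => [x|x].
  rewrite !inE; apply/idP/idP.
    move=> /andP[/andP[/eqP xn x0] /eqP dx].
    have xE : (fun j => up x j : nat) = unit_shift (fun j => x j) i
      by exact/upE/upN.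
    have /eqP := xn.
    rewrite -[X in X == _](_ : \sum_(j < k) j.+1 * unit_shift (fun j => x j) i
      j = _)%N; last first.
      by apply: eq_bigr => j _; rewrite -[in LHS]xE.
    by rewrite (sum_unit_shift _ i (fun j => j.+1)) addnC eqn_add2l.
  move=> xn.
  have xiN : (x i < N)%N.
    have : x \in solutions N n by rewrite inE.
    by move=> /(solutions_le i) h; lia.
  have xE := upE _ xiN.
  have xE' j : (up x j : nat) = unit_shift (fun j => x j) i j by rewrite -xE.
  apply/andP; split; [apply/andP; split|].
  - under eq_bigr do rewrite xE'.
    by rewrite (sum_unit_shift _ i (fun j => j.+1)) addnC eqn_add2l.
  - by rewrite xE' /unit_shift eqxx addn1.
  - apply/eqP/ffunP => j; rewrite ffunE xE' /unit_shift addnK.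
    exact: inord_val.
move=> /andP[/andP[_ x0] /eqP dx].
have xE : (fun j => up x j : nat) = unit_shift (fun j => x j) i
  by exact/upE/upN.
have xE' j : (up x j : nat) = unit_shift (fun j => x j) i j by rewrite -xE.
rewrite xE xE' [in X in X%:R]/unit_shift eqxx addn1 mulrA weight_unit_shift.
rewrite /monom mulrA; congr (_ * _ ^+ _).
under eq_bigr do rewrite xE' -[unit_shift _ _ _]mul1n.
rewrite (sum_unit_shift _ i (fun=> 1%N)) addn1 /=.
by apply: eq_bigr => j _; rewrite mul1n.
Qed.

Lemma solutions_small N n (i : 'I_k) (x : {ffun 'I_k -> 'I_N.+1}) :
  (n < i.+1)%N -> x \in solutions N n -> x i = 0%N :> nat.
Proof.
move=> ni; rewrite inE => /eqP; rewrite (bigD1 i)//= => xn.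
by apply/eqP; rewrite -leqn0 leqNgt; apply/negP => xi; nia.
Qed.

(** The exponent brought down by differentiation is the sum of the entries; it splits over [i], and
    [sum_solutions_shift] evaluates each part. For [n <= i] the entry [x i] is forced to be 0. *)
Lemma is_derive_gcp_poly n (t : R) :
  is_derive t (1 : R) (gcp_poly n)
    (\sum_(i < k | (i < n)%N) lam i * gcp_poly (n - i.+1) t).
Proof.
have -> : \sum_(i < k | (i < n)%N) lam i * gcp_poly (n - i.+1) t =
    \sum_(x in Omega k n) weight (fun j => x j) *
    ((\sum_(j < k) x j)%N%:R * t ^+ (\sum_(j < k) x j)%N.-1).
  (* With the common bound [n], the sums for all [n - i.+1] live in one type. *)
  rewrite -(@sum_solutions n n (fun f => weight f *
    ((\sum_(j < k) f j)%N%:R * t ^+ (\sum_(j < k) f j)%N.-1)))//.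
  transitivity (\sum_(x in solutions n n) \sum_(i < k)
      (x i)%:R * (weight (fun j => x j) * t ^+ (\sum_(j < k) x j)%N.-1));
        last first.
    by apply: eq_bigr => x _; rewrite -mulr_suml -natr_sum mulrCA.
  rewrite exchange_big /= [RHS](bigID (fun i : 'I_k => (i < n)%N)) /=.
  rewrite [X in _ = _ + X]big1 ?addr0; last first.
    move=> i; rewrite -leqNgt => ni; rewrite big1// => x xn.
    by rewrite (@solutions_small n n)// mul0r.
  apply: eq_bigr => i ni.
  have := @sum_solutions_shift n (n - i.+1) i t; rewrite subnKC// => ->//.
  by rewrite (@sum_solutions _ _ (fun f => monom f t)) ?leq_subr.
rewrite /gcp_poly.
rewrite (_ : (fun t : R => \sum_(x in Omega k n) monom (fun j => x j) t) =
  \sum_(x in Omega k n) monom (fun j => x j)); last first.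
  by apply/funext => s; rewrite fct_sumE.
elim/big_ind2 : _ => [|f f' g g' ? ?|x _]; first exact: is_derive_cst.
  exact: is_deriveD.
have h := DeriveDef (@exprn_derivable R (\sum_(j < k) x j)%N t 1) (exp_derive _
  t 1).
apply: (is_derive_eq (is_deriveZ (weight (fun j => x j)) h)).
by rewrite /GRing.scale /= mulr1.
Qed.

Definition gcp_coef (n : nat) (t : R) : R :=
  gcp_poly n t * expR (- (total_rate lam * t)).

Lemma is_derive_gcp_coef n (t : R) :
  is_derive t (1 : R) (gcp_coef n)
    (- total_rate lam * gcp_coef n t +
     \sum_(i < k | (i < n)%N) lam i * gcp_coef (n - i.+1) t).
Proof.
have he : is_derive t (1 : R) (fun s : R => expR (- (total_rate lam * s)))
    (expR (- (total_rate lam * t)) * - total_rate lam).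
  apply: (@is_derive1_comp _ expR (fun s : R => - (total_rate lam * s))).
  have h := is_deriveN (is_deriveZ (total_rate lam) (is_derive_id t 1)).
  by apply: (is_derive_eq h); rewrite /GRing.scale /= mulr1.
apply: (is_derive_eq (is_deriveM (is_derive_gcp_poly n t) he)).
rewrite /GRing.scale /= /gcp_coef; under [in RHS]eq_bigr do rewrite mulrA.
by rewrite -mulr_suml; ring.
Qed.

Lemma gcp_coef_ge0 n (t : R) : (forall j, 0 < lam j) -> 0 <= t ->
  0 <= gcp_coef n t.
Proof.
move=> lam0 t0; rewrite mulr_ge0 ?expR_ge0//; apply: sumr_ge0 => x _.
rewrite mulr_ge0 ?exprn_ge0//; apply: prodr_ge0 => j _.
by rewrite divr_ge0// exprn_ge0// ltW.
Qed.

Lemma gcp_coef0n (t : R) : gcp_coef 0 t = expR (- (total_rate lam * t)).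
Proof.
rewrite /gcp_coef /gcp_poly (big_pred1 [ffun=> ord0]) /=.
  rewrite /monom /weight !big1 ?mul1r// => j _; rewrite ffunE//.
  by rewrite expr0 fact0 divr1.
move=> x; rewrite inE sum_nat_eq0; apply/forallP/eqP => /= [x0|-> j].
  apply/ffunP => j; rewrite ffunE; apply/val_inj/eqP => /=.
  by have := x0 j; rewrite muln_eq0.
by rewrite ffunE muln0.
Qed.

(** For [n > 0] a solution has a nonzero entry, so its monomial has positive degree and vanishes at
    0. *)
Lemma gcp_coefn0 n : gcp_coef n 0 = (n == 0)%:R.
Proof.
case: n => [|n]; first by rewrite gcp_coef0n mulr0 oppr0 expR0.
rewrite /gcp_coef /gcp_poly big1 ?mul0r// => x; rewrite inE => /eqP xn.
rewrite /monom expr0n; case: eqP => [x0|]; rewrite ?mulr0//.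
move: xn; rewrite big1// => j _.
by move/eqP: x0; rewrite sum_nat_eq0 => /forallP/(_ j)/eqP ->; rewrite muln0.
Qed.

End Coefficients.

(** * Convolution semigroups: differentiability and uniqueness *)

Section Semigroup.
Context {R : realType}.

(** Turns limits at 0 from the right into two-sided limits along [|h|], as a two-sided derivative
    requires. *)
Lemma cvg_norm_dnbhs_at_right : `|h| @[h --> (0 : R)^'] --> (0 : R)^'+.
Proof.
move=> A [e /= e0 Ae]; exists e => //= h he h0.
apply: Ae; last by rewrite normr_gt0.
by rewrite /= distrC subr0 normr_id; move: he; rewrite /= ?sub0r ?normrN.
Qed.

Lemma cvg_sum_ord (T : Type) (F : set_system T) {FF : Filter F} (n : nat)
    (f : 'I_n -> T -> R) (a : 'I_n -> R) :
  (forall i, f i x @[x --> F] --> a i) ->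
  \sum_(i < n) f i x @[x --> F] --> \sum_(i < n) a i.
Proof.
by move=> fa; apply: cvg_big => [|i _]; [exact: add_continuous|exact: fa].
Qed.

Section Generator.
Variables (p : nat -> R -> R) (l : nat -> R).
Hypothesis p_bounded : forall n (t : R), 0 <= t -> 0 <= p n t <= 1.
Hypothesis p_conv : forall n (s h : R), 0 <= s -> 0 <= h ->
  p n (s + h) = \sum_(m < n.+1) p m s * p (n - m)%N h.
Hypothesis p_generator : forall j,
  (p j h - (j == 0)%:R) / h @[h --> 0^'+] --> l j.

Let r j h := p j h - (j == 0)%:R.

(** The part [(n - m == 0)%:R] of [p (n - m) h] selects [m = n] and reproduces [p n s]. *)
Lemma convolution_incr n (s h : R) : 0 <= s -> 0 <= h ->
  p n (s + h) - p n s = \sum_(m < n.+1) p m s * r (n - m) h.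
Proof.
move=> s0 h0; rewrite p_conv// /r.
under [in RHS]eq_bigr do rewrite mulrBr; rewrite sumrB; congr (_ - _).
rewrite big_ord_recr /= subnn eqxx mulr1 big1 ?add0r// => i _.
by rewrite subn_eq0 leqNgt ltn_ord mulr0.
Qed.

Lemma cvg_generator_norm j : r j `|h| / `|h| @[h --> (0 : R)^'] --> l j.
Proof. exact: (cvg_comp _ _ cvg_norm_dnbhs_at_right (@p_generator j)). Qed.

Lemma cvg_incr_norm j : r j `|h| @[h --> (0 : R)^'] --> (0 : R).
Proof.
have h0 : `|h| @[h --> (0 : R)^'] --> (0 : R).
  exact: cvg_trans cvg_norm_dnbhs_at_right (cvg_within _).
have : r j `|h| / `|h| * `|h| @[h --> (0 : R)^'] --> l j * 0.
  by apply: cvgM; [exact: cvg_generator_norm|exact: h0].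
rewrite mulr0; apply: cvg_trans; apply: near_eq_cvg; near=> h.
rewrite /= divfK// normr_eq0; near: h; exact: nbhs_dnbhs_neq.
Unshelve. all: by end_near. Qed.

Lemma cvg_semigroup0 n : p n h @[h --> 0^'+] --> ((n == 0)%:R : R).
Proof.
have h0 : h @[h --> (0 : R)^'+] --> (0 : R) by exact/cvg_within.
have : (p n h - (n == 0)%:R) / h * h + (n == 0)%:R @[h --> 0^'+] -->
    l n * 0 + (n == 0)%:R.
  by apply: cvgD; [apply: cvgM; [exact: p_generator|exact: h0]|exact: cvg_cst].
rewrite mulr0 add0r; apply: cvg_trans; apply: near_eq_cvg; near=> h.
by rewrite /= divfK ?subrK// gt_eqF.
Unshelve. all: by end_near. Qed.

(* Evaluating at [Num.min t (t + h)] treats left and right increments at once: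
   the convolution identity only goes forward in time. *)
Lemma cvg_semigroup_min n (t : R) : 0 < t ->
  p n (Num.min t (t + h)) @[h --> (0 : R)^'] --> p n t.
Proof.
(* For [h < 0] the increment from [t + h] to [t] is at most [S h] in absolute value, since each
   [p m] lies in [0, 1]; otherwise the minimum is [t] itself. *)
move=> t0; pose S (h : R) := \sum_(m < n.+1) `|r (n - m) `|h| |.
have S0 : S h @[h --> (0 : R)^'] --> (0 : R).
  rewrite [X in _ --> X](_ : 0 = \sum_(m < n.+1) `|0 : R|);
    last by rewrite big1// => i _; rewrite normr0.
  apply: cvg_sum_ord => i; apply: cvg_norm; exact: (@cvg_incr_norm (n - i)).
have S_ge0 h : 0 <= S h by apply: sumr_ge0.
apply: (@squeeze_cvgr _ _ _ _ (fun h => p n t - S h) (fun h => p n t + S h)).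
- near=> h.
  have th0 : 0 <= t + h.
    have : `|h| < t by near: h; exact: dnbhs0_lt.
    by rewrite ltr_norml; lra.
  have [h0|h0] := leP t (t + h).
    by rewrite lerBlDr !lerDl !S_ge0.
  rewrite -ler_distlC.
  have hn : `|h| = - h by rewrite ltr0_norm//; lra.
  have := @convolution_incr n (t + h) `|h| th0 (normr_ge0 h).
  rewrite [in LHS]hn addrK => ->.
  rewrite (le_trans (ler_norm_sum _ _ _))//; apply: ler_sum => i _.
  rewrite normrM ler_piMl//.
  by have /andP[? ?] := p_bounded i th0; rewrite ger0_norm.
- by rewrite -[X in _ --> X]subr0; apply: cvgB => //; exact: cvg_cst.
- by rewrite -[X in _ --> X]addr0; apply: cvgD => //; exact: cvg_cst.
Unshelve. all: by end_near. Qed.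

(** For either sign of [h] the increment is run forward from the smaller of [t] and [t + h] over a
    time [|h|]; the two sign changes cancel in the quotient, and both factors of each term
    converge. *)
Lemma is_derive_semigroup n (t : R) : 0 < t ->
  is_derive t (1 : R) (p n) (\sum_(m < n.+1) p m t * l (n - m)).
Proof.
move=> t0.
have D : h^-1 *: ((p n \o shift t) (h *: 1) - p n t) @[h --> (0 : R)^'] -->
    \sum_(m < n.+1) p m t * l (n - m).
  have : \sum_(m < n.+1) p m (Num.min t (t + h)) * (r (n - m) `|h| / `|h|)
      @[h --> (0 : R)^'] --> \sum_(m < n.+1) p m t * l (n - m).
    apply: cvg_sum_ord => i; apply: cvgM; first exact: cvg_semigroup_min.
    exact: cvg_generator_norm.
  apply: cvg_trans; apply: near_eq_cvg; near=> h.
  have h0 : h != 0 by near: h; exact: nbhs_dnbhs_neq.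
  have th0 : 0 <= t + h.
    have : `|h| < t by near: h; exact: dnbhs0_lt.
    by rewrite ltr_norml; lra.
  rewrite /GRing.scale /= mulr1 [h + t]addrC.
  under eq_bigr do rewrite mulrA; rewrite -mulr_suml mulrC.
  have [tle|tgt] := leP t (t + h).
    by rewrite -convolution_incr ?(ltW t0)// ger0_norm//; lra.
  have hn : `|h| = - h by rewrite ltr0_norm//; lra.
  rewrite -convolution_incr// hn addrK invrN mulNr -mulrN opprB//.
by apply: DeriveDef; [apply/cvg_ex; eexists; exact: D|exact/cvg_lim].
Unshelve. all: by end_near. Qed.

End Generator.

(** By induction the terms [m < n] cancel in [f n - g n], which leaves the scalar equation
    [D' = l 0 * D] with [D 0 = 0]. *)
Lemma convolution_ode_unique (f g : nat -> R -> R) (l : nat -> R) :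
  (forall n (t : R), 0 < t ->
    is_derive t (1 : R) (f n) (\sum_(m < n.+1) f m t * l (n - m)%N)) ->
  (forall n (t : R), 0 < t ->
    is_derive t (1 : R) (g n) (\sum_(m < n.+1) g m t * l (n - m)%N)) ->
  (forall n, f n h @[h --> 0^'+] --> f n 0) ->
  (forall n, g n h @[h --> 0^'+] --> g n 0) ->
  (forall n, f n 0 = g n 0) ->
  forall n (t : R), 0 <= t -> f n t = g n t.
Proof.
move=> df dg f0 g0 fg0; elim/ltn_ind => n IH t.
rewrite le_eqVlt => /predU1P[<-//|t0].
(* An integrating factor: the product [F] below has derivative zero. *)
pose e (s : R) := expR (- l 0 * s).
have de (s : R) : is_derive s (1 : R) e (- l 0 * e s).
  have h := is_deriveZ (- l 0) (is_derive_id s 1).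
  apply: (is_derive_eq (@is_derive1_comp _ expR _ _ _ _ _ h)).
  by rewrite /GRing.scale /= mulr1 mulrC.
pose F := (f n - g n) * e : R -> R.
have dF (s : R) : 0 < s -> is_derive s (1 : R) F (cst 0 s).
  move=> s0; have h := is_deriveM (is_deriveB (df n s s0) (dg n s s0)) (de s).
  apply: (is_derive_eq h); rewrite /GRing.scale /=.
  rewrite !big_ord_recr /= subnn.
  rewrite (eq_bigr (fun m : 'I_n => g m s * l (n - m)%N)); last first.
    by move=> i _; rewrite IH// ltW.
  by rewrite !fctE; ring.
have cF (s : R) : 0 < s -> {for s, continuous F}.
  by move=> /dF[? _]; exact/differentiable_continuous/derivable1_diffP.
(* The derivative of [F] is known at positive times only; its continuity at 0 comes from the right
   limits of [f] and [g]. *)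
have ctF : {within `[0, t], continuous F}.
  apply/(continuous_within_itvP _ t0); split.
  - by move=> s; rewrite in_itv /= => /andP[/cF].
  - apply: cvgM; first exact: cvgB.
    have [? _] := de 0.
    exact/cvg_at_right_filter/differentiable_continuous/derivable1_diffP.
  - exact/cvg_at_left_filter/cF.
have dF' s : s \in `]0, t[ -> is_derive s (1 : R) F (cst 0 s).
  by rewrite in_itv /= => /andP[s0 _]; exact: dF.
have [s _] := MVT t0 dF' ctF.
rewrite mul0r => /subr0_eq; rewrite /F !fctE fg0 subrr mul0r => /eqP.
have /negPf e0 : e t != 0 by rewrite gt_eqF ?expR_gt0.
by rewrite mulf_eq0 e0 orbF subr_eq0 => /eqP.
Qed.

End Semigroup.

(** * Jump rates indexed by all natural numbers *)

Section Rates.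
Context {R : realType} {k : nat} (lam : 'I_k -> R).

(** Indexing by jump size makes the system a convolution: size 0 carries minus the total rate, and
    the default 0 covers sizes above [k]. *)
Definition gcp_rate (j : nat) : R :=
  if j is i.+1 then oapp lam 0 (insub i) else - total_rate lam.

Lemma gcp_rateS (i : 'I_k) : gcp_rate i.+1 = lam i.
Proof. by rewrite /= valK. Qed.

Lemma gcp_rate_gt j : (k < j)%N -> gcp_rate j = 0.
Proof.
by case: j => //= j; rewrite ltnS leqNgt => /negPf kj; rewrite insubF.
Qed.

Lemma sum_gcp_rate n (c : nat -> R) :
  \sum_(m < n.+1) c m * gcp_rate (n - m)%N =
  - total_rate lam * c n + \sum_(i < k | (i < n)%N) lam i * c (n - i.+1)%N.
Proof.
rewrite big_ord_recr /= subnn addrC [c n * _]mulrC; congr (_ + _).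
(* At most one [i] satisfies [i.+1 = n - m], and none when [n - m > k]; this inner sum prepares the
   exchange of the two summations. *)
rewrite (eq_bigr (fun m : 'I_n => \sum_(i < k | i.+1 == (n - m)%N) lam i * c
  m)); last first.
  move=> m _; have [nmk|nmk] := leqP (n - m) k.
    have nm0 : (n - m = (n - m).-1.+1)%N by rewrite prednK// subn_gt0.
    have nmk' : ((n - m).-1 < k)%N by rewrite -nm0.
    rewrite (big_pred1 (Ordinal nmk')) /=; last first.
      move=> i; apply/eqP/eqP => [im|-> /=]; last by rewrite -nm0.
      by apply/val_inj => /=; rewrite -im.
    by rewrite [in LHS]nm0 (gcp_rateS (Ordinal nmk')) mulrC.
  rewrite gcp_rate_gt// mulr0 big_pred0// => i.
  by apply/negbTE; rewrite neq_ltn (leq_ltn_trans _ nmk).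
rewrite (exchange_big_dep (fun i : 'I_k => (i < n)%N)) /=; last first.
  by move=> m i _ /eqP im; have := leq_subr m n; rewrite -im.
apply: eq_bigr => i ni; have nin : (n - i.+1 < n)%N by lia.
rewrite (big_pred1 (Ordinal nin))// => m.
have mn := ltn_ord m; apply/eqP/eqP => [im|-> /=]; last by lia.
by apply/val_inj => /=; lia.
Qed.

End Rates.

(** * State probabilities of the counting process *)

Section Transition.
Context (d : measure_display) (T : measurableType d) (R : realType).
Variable P : probability T R.

Lemma measure_setI_full (A Z : set T) : measurable A -> measurable Z ->
  P (~` Z) = 0%E -> P (A `&` Z) = P A.
Proof.
move=> mA mZ Z0.
rewrite [RHS](@measureDI _ _ _ P A Z mA mZ) [X in (X + _)%E](_ : _ = 0%E)
  ?add0e//.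
apply/eqP; rewrite eq_le measure_ge0 andbT -Z0 le_measure ?inE//.
- exact: measurableD.
- exact: measurableC.
Qed.

Lemma measurable_RV_eq (X : {RV P >-> nat}) n : measurable [set w | X w = n].
Proof.
by rewrite -[X in measurable X]/(X @^-1` [set n]); exact: measurable_funPTI.
Qed.

Lemma measure_split_nat (X : {RV P >-> nat}) (A : set T) (N : nat) : measurable
  A ->
  P A = (\sum_(m < N) P (A `&` [set w | X w = m]) +
         P (A `&` [set w | (N <= X w)%N]))%E.
Proof.
move=> mA; have mge n : measurable [set w | (n <= X w)%N].
  by rewrite -[X in measurable X]/(X @^-1` [set m | (n <= m)%N]);
    exact: measurable_funPTI.
elim: N => [|N ->].
  by rewrite big_ord0 add0e [X in _ `&` X](_ : _ = setT) ?setIT//; exact/seteqP.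
rewrite big_ord_recr /= -addeA; congr (_ + _)%E.
rewrite -measureU.
- rewrite -setIUr; congr (P (_ `&` _)); apply/seteqP; split => w /=.
    by rewrite leq_eqVlt => /predU1P[->|]; [left|right].
  by case=> [->//|/ltnW].
- exact/measurableI/measurable_RV_eq.
- exact/measurableI/mge.
- by apply/seteqP; split => w //= [[_ ->] [_]]; rewrite ltnn.
Qed.

Variables (k : nat) (lam : 'I_k -> R) (M : R -> {RV P >-> nat}).
Hypothesis gcpM : generalized_counting_process lam M.

Definition count_prob (n : nat) (t : R) : R := fine (P [set w | M t w = n]).

Lemma count_probE n t : P [set w | M t w = n] = (count_prob n t)%:E.
Proof. by rewrite fineK// fin_num_measure//; exact: measurable_RV_eq. Qed.

Lemma count_prob_bounded n t : 0 <= count_prob n t <= 1.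
Proof.
by rewrite -!lee_fin -count_probE measure_ge0 probability_le1//;
  exact: measurable_RV_eq.
Qed.

Lemma start_null : P (~` [set w | M 0 w = 0%N]) = 0%E.
Proof.
have [[ae0 _ _ _] _] := gcpM.
apply/negligibleP; first exact/measurableC/measurable_RV_eq.
apply: negligibleS ae0 => w /=; apply: contra_not => /eqP.
by rewrite pnatr_eq0 => /eqP.
Qed.

Lemma count_prob0 n : count_prob n 0 = (n == 0)%:R.
Proof.
rewrite /count_prob -(measure_setI_full (measurable_RV_eq _ _)
  (measurable_RV_eq (M 0) 0) start_null).
case: n => [|n] /=.
  rewrite setIid -[X in P X]setCK probability_setC ?start_null ?sube0//.
  exact/measurableC/measurable_RV_eq.
rewrite [X in P X](_ : _ = set0) ?measure0//.
by apply/seteqP; split => w //= [->].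
Qed.

Let X (t : R) (w : T) : R := (M t w)%:R.

Lemma X_eqE t m : X t @^-1` [set m%:R] = [set w | M t w = m].
Proof.
apply/seteqP; split => w /=; last by rewrite /X => ->.
by rewrite /X => /eqP; rewrite eqr_nat => /eqP.
Qed.

(** Independence is applied to the partition 0, [s], [s + h], where [M s] is almost surely an
    increment because [M 0] is almost surely 0; stationarity then identifies the second factor. *)
Lemma joint_count_prob (s h : R) (m j : nat) : 0 <= s -> 0 <= h ->
  P [set w | M s w = m /\ M (s + h) w = (m + j)%N] =
  (count_prob m s * count_prob j h)%:E.
Proof.
move=> s0 h0; have [[_ ind sta _] _] := gcpM.
(* Constant from index 2 on, to be nondecreasing as a whole sequence. *)
pose t (i : nat) : R := if i is i'.+1 then if i' is _.+1 then s + h else s else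
  0.
pose B (i : nat) : set R := if i is _.+1 then [set j%:R] else [set m%:R].
have tmono (a b : nat) : (a <= b)%N -> t a <= t b.
  by case: a b => [|[|a]] [|[|b]] //= _; rewrite ?lexx ?lerDl ?addr_ge0.
have mB i : measurable (B i) by case: i => [|i]; exact: measurable_set1.
have := ind 2%N t B (lexx _) tmono mB.
rewrite !big_ord_recl big_ord0 mule1 /=.
rewrite !sta ?lerDl//; [|exact: measurable_set1..].
rewrite subr0 addrAC subrr add0r.
rewrite -!/(X _) !X_eqE !count_probE -EFinM => <-.
have mE : measurable [set w | M s w = m /\ M (s + h) w = (m + j)%N].
  exact: (measurableI _ _ (measurable_RV_eq (M s) m) (measurable_RV_eq (M (s +
    h)) (m + j))).
have mI a b c : measurable (increment X a b @^-1` [set c%:R : R]).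
  rewrite -[X in measurable X]setTI.
  apply: (measurable_funB (f := X b) (g := X a)) => //;
    exact: (@measurableT_comp _ _ _ _ _ _ (fun n : nat => n%:R : R)).
have mZ := measurable_RV_eq (M 0) 0.
(* The two events are compared only where [M 0] vanishes, so both are first cut down to that event
   of probability 1. *)
rewrite -(measure_setI_full mE mZ start_null).
rewrite -[RHS](measure_setI_full _ mZ start_null); last first.
  by apply: bigcap_measurable => [|[|i] _]; [exists 0%N|exact: mI..].
congr (P _); apply/seteqP; split => w /=.
  move=> [[Ms Msh] M0]; split=> // -[|[|//]] _ /=; rewrite /increment /X.
    by rewrite Ms M0 subr0.
  by rewrite Ms Msh natrD addrAC subrr add0r.
move=> [cap M0]; split=> //.
have /eqP := cap 0%N isT; rewrite /= /increment /X M0 subr0 eqr_nat => /eqP Ms.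
have /eqP := cap 1%N isT; rewrite /= /increment /X Ms subr_eq -natrD eqr_nat
  addnC.
by move=> /eqP.
Qed.

(* The increment over [s, s + h] is distributed as [M h], which is nonnegative.
  *)
Lemma count_prob_decr (s h : R) n : 0 <= s -> 0 <= h ->
  P ([set w | M (s + h) w = n] `&` [set w | (n.+1 <= M s w)%N]) = 0%E.
Proof.
move=> s0 h0; have [[_ _ sta _] _] := gcpM.
have mneg : measurable `]-oo, (0 : R)[ by [].
have ssh : s <= s + h by rewrite lerDl.
have := sta s (s + h) _ s0 ssh mneg.
rewrite [X in _ = P X](_ : _ = set0) ?measure0; last first.
  by apply/seteqP; split => w //=; rewrite in_itv /= ltNge ler0n.
move=> N0; apply/eqP; rewrite eq_le measure_ge0 andbT -N0.
apply: le_measure; rewrite ?inE.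
- apply: measurableI; first exact: measurable_RV_eq.
  rewrite -[X in measurable X]/(M s @^-1` [set m | (n < m)%N]).
  exact: measurable_funPTI.
- rewrite -[X in measurable X]setTI.
  apply: (measurable_funB (f := X (s + h)) (g := X s)) => //;
    exact: (@measurableT_comp _ _ _ _ _ _ (fun n : nat => n%:R : R)).
- by move=> w /= [Mn nM]; rewrite in_itv /= /increment Mn subr_lt0 ltr_nat.
Qed.

(** The event is split by the value of [M s]; values above [n] carry no mass by
    [count_prob_decr]. *)
Lemma count_prob_convolution n (s h : R) : 0 <= s -> 0 <= h ->
  count_prob n (s + h) = \sum_(m < n.+1) count_prob m s * count_prob (n - m) h.
Proof.
move=> s0 h0; apply: EFin_inj.
rewrite -count_probE (measure_split_nat (M s) n.+1 (measurable_RV_eq _ _)).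
rewrite count_prob_decr// adde0 -sumEFin; apply: eq_bigr => m _.
rewrite -(@joint_count_prob s h m (n - m) s0 h0).
rewrite subnKC; last by rewrite -ltnS.
congr (P _); by apply/seteqP; split => w /= [].
Qed.

(** The transition rates are taken at time 0 and state 0, where the conditioning event has
    probability 1 and drops out. *)
Lemma count_prob_generator j :
  (count_prob j h - (j == 0)%:R) / h @[h --> 0^'+] --> gcp_rate lam j.
Proof.
have [_ gen] := gcpM.
have P0 : P [set w | M 0 w = 0%N] = 1%E by rewrite count_probE count_prob0.
have P0' : P [set w | M 0 w = 0%N] != 0%E by rewrite P0 eqe oner_eq0.
have transE i : (fun h => cond_prob P [set w | M (0 + h) w = (0 + i)%N]
    [set w | M 0 w = 0%N]) = count_prob i.
  apply/funext => h; rewrite /cond_prob P0 divr1.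
  rewrite (measure_setI_full (measurable_RV_eq _ _) (measurable_RV_eq (M 0) 0)
    start_null).
  by rewrite !add0r.
have [g0 gS gk] := gen 0 0%N (lexx _) P0'.
have {}g0 : (fun h => count_prob 0 h - (1 - total_rate lam * h)) =o_ (0^'+) id.
  by rewrite -(transE 0%N).
have {}gS (i : 'I_k) : (fun h => count_prob i.+1 h - lam i * h) =o_ (0^'+) id.
  by rewrite -(transE i.+1).
have {}gk i : (k < i)%N -> count_prob i =o_ (0^'+) id.
  by rewrite -(transE i); exact: gk.
suff : (fun h => count_prob j h - (j == 0)%:R - gcp_rate lam j * h) =o_ (0^'+)
  id.
  move=> /eqoP jo; apply/cvgrPdist_le => e e0; near=> h.
  have h0 : 0 < h by [].
  have jh : `|count_prob j h - (j == 0)%:R - gcp_rate lam j * h| <= e * `|h|.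
    by near: h; exact: jo.
  rewrite distrC -[gcp_rate lam j](mulfK (lt0r_neq0 h0)).
  by rewrite -mulrBl normf_div ler_pdivrMr ?normr_gt0 ?lt0r_neq0.
case: j => [|j].
  by rewrite (_ : (fun h : R => _) =
    fun h => count_prob 0 h - (1 - total_rate lam * h))//;
      apply/funext => h /=; ring.
have [jk|kj] := leqP j.+1 k.
  rewrite (_ : (fun h : R => _) =
    fun h => count_prob j.+1 h - lam (Ordinal jk) * h);
      first exact: (gS (Ordinal jk)).
  by apply/funext => h; rewrite (gcp_rateS lam (Ordinal jk)) subr0.
rewrite gcp_rate_gt// (_ : (fun h : R => _) = count_prob j.+1); first exact: gk.
by apply/funext => h; rewrite mul0r !subr0.
Unshelve. all: by end_near. Qed.

Lemma count_prob_gcp_coef n (t : R) : 0 <= t -> count_prob n t = gcp_coef lam n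
  t.
Proof.
apply: (@convolution_ode_unique _ _ _ (gcp_rate lam)) => {n t} n.
- move=> t t0; apply: is_derive_semigroup => //.
  + by move=> *; exact: count_prob_bounded.
  + exact: count_prob_convolution.
  + exact: count_prob_generator.
- by move=> t t0; rewrite (sum_gcp_rate _ _ (gcp_coef lam ^~ t));
    exact: is_derive_gcp_coef.
- rewrite count_prob0; apply: cvg_semigroup0; exact: count_prob_generator.
- have [? _] := is_derive_gcp_coef lam n 0.
  exact/cvg_at_right_filter/differentiable_continuous/derivable1_diffP.
- by rewrite count_prob0 gcp_coefn0.
Qed.

End Transition.

(** * The generalized density as a measure and its pairings *)

Section Law.
Context {R : realType} {k : nat} (lam : 'I_k -> R) (b : R).
Hypothesis lam_gt0 : forall j, 0 < lam j.

Lemma eseries_finite (u : nat -> \bar R) (N : nat) :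
  (forall n, (N <= n)%N -> u n = 0%E) ->
  (\sum_(0 <= n <oo) u n = \sum_(n < N) u n)%E.
Proof.
move=> uN; apply: lim_near_cst => //; exists N => //= n Nn.
rewrite (@big_cat_nat _ _ _ N)//= big_mkord [X in (_ + X)%E]big1_seq ?adde0//
  => i.
by rewrite mem_index_iota => /andP[_ /andP[Ni _]]; exact: uN.
Qed.

Lemma gcp_lawE (t : R) (A : set R) :
  gcp_law lam b t A =
  (\sum_(0 <= n <oo) (gcp_coef lam n t)%:E * \d_(n%:R + b * t)%R A)%E.
Proof.
apply: eq_eseriesr => n _; rewrite diracE /gcp_coef /gcp_poly.
under eq_bigr do rewrite -EFinM.
rewrite sumEFin -EFinM; congr EFin; rewrite -!mulr_suml.
by congr (_ * _ * _); apply: eq_bigr => x _; rewrite monomE.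
Qed.

(** Gives the set function [gcp_law] the structure of a measure, a series of Dirac masses with
    nonnegative coefficients, so that integration theory applies. *)
Definition gcp_measure (t : R) (t0 : 0 <= t) : {measure set R -> \bar R} :=
  mseries (fun n => mscale (NngNum (gcp_coef_ge0 n lam_gt0 t0)) \d_(n%:R + b *
    t)) 0.

Lemma gcp_law_measure (t : R) (t0 : 0 <= t) :
  gcp_law lam b t = gcp_measure t0.
Proof. by apply/funext => A; rewrite gcp_lawE. Qed.

Lemma ge0_integral_gcp_law (t : R) (f : R -> \bar R) : 0 <= t ->
  measurable_fun setT f -> (forall y, 0 <= f y)%E ->
  (\int[gcp_law lam b t]_y f y =
   \sum_(0 <= n <oo) (gcp_coef lam n t)%:E * f (n%:R + b * t)%R)%E.
Proof.
move=> t0 mf f0; rewrite (gcp_law_measure t0) ge0_integral_measure_series//.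
apply: eq_eseriesr => n _; rewrite ge0_integral_mscale// integral_dirac//.
by rewrite diracT mul1e.
Qed.

(** The atoms [n%:R + b * t] with [N <= n] lie where [phi] vanishes. *)
Lemma gf_of_gcp_law (t : R) (phi : R -> R) (N : nat) : 0 <= t -> 0 <= b ->
  measurable_fun setT phi -> (forall y, N%:R <= y -> phi y = 0) ->
  gf_of (gcp_law lam b t) phi =
  \sum_(n < N) gcp_coef lam n t * phi (n%:R + b * t).
Proof.
move=> t0 b0 mphi phiN.
have phi0 n : (N <= n)%N -> phi (n%:R + b * t) = 0.
  by move=> Nn; rewrite phiN// (le_trans (_ : _ <= n%:R)) ?ler_nat// lerDl
    mulr_ge0.
have mE : measurable_fun setT (EFin \o phi) by exact/measurable_EFinP.
(* [phi] may change sign: its positive and negative parts are integrated separately, and both series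
   are finite. *)
rewrite /gf_of (gcp_law_measure t0) integralE -!(gcp_law_measure t0).
rewrite !ge0_integral_gcp_law//;
  [|exact/measurable_funeneg|exact/measurable_funepos].
rewrite !(@eseries_finite _ N); last 2 first.
- by move=> n Nn; rewrite funenegE /= phi0// oppr0 maxxx mule0.
- by move=> n Nn; rewrite funeposE /= phi0// maxxx mule0.
rewrite (eq_bigr (fun n : 'I_N =>
    (gcp_coef lam n t * Num.max (phi (n%:R + b * t)) 0)%:E)); last first.
  by move=> n _; rewrite [in RHS]EFinM EFin_max funeposE.
rewrite [X in (_ - X)%E](eq_bigr (fun n : 'I_N =>
    (gcp_coef lam n t * Num.max (- phi (n%:R + b * t)) 0)%:E)); last first.
  by move=> n _; rewrite [in RHS]EFinM EFin_max EFinN funenegE.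
rewrite !sumEFin -EFinB /= -sumrB; apply: eq_bigr => n _.
rewrite -mulrBr; congr (_ * _).
by have [?|?] := leP (phi (n%:R + b * t)) 0; have [?|?] := leP (- phi (n%:R + b
  * t)) 0; lra.
Qed.

End Law.

(** * Regularity and support of test functions *)

Section TestFunctions.
Context {R : realType}.
Implicit Types phi : R -> R.

Lemma test_function_is_derive phi (x : R) : test_function phi ->
  is_derive x (1 : R) phi (derive1 phi x).
Proof.
by move=> [dphi _]; apply: DeriveDef; [exact: (dphi 0%N)|rewrite derive1E].
Qed.

Lemma test_function_continuous phi : test_function phi -> continuous phi.
Proof.
by move=> [dphi _] x; exact/differentiable_continuous/derivable1_diffP/(dphi
  0%N).
Qed.

Lemma test_function_continuous_derive1 phi :
  test_function phi -> continuous (derive1 phi).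
Proof.
by move=> [dphi _] x; exact/differentiable_continuous/derivable1_diffP/(dphi
  1%N).
Qed.

(** [N] is taken strictly beyond a bound of the support, so [phi] vanishes near every [y >= N] and
    its derivative vanishes there too. *)
Lemma test_function_eventually0 phi : test_function phi ->
  exists N : nat, forall y, N%:R <= y -> phi y = 0 /\ derive1 phi y = 0.
Proof.
move=> [_ [K cK phiK]]; have [B [_ KB]] := compact_bounded cK.
have B1 : 0 <= `|B| + 1 by rewrite addr_ge0.
have phi0 y : `|B| + 1 < y -> phi y = 0.
  move=> By; apply: phiK => /(KB (`|B| + 1)).
  rewrite ltr_pwDr ?ler_norm// => /(_ isT) /= yB.
  by have := le_lt_trans (le_trans (ler_norm y) yB) By; rewrite ltxx.
exists (Num.bound (`|B| + 1)) => y Ny.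
have By : `|B| + 1 < y by exact: lt_le_trans (archi_boundP B1) Ny.
split; first exact: phi0.
rewrite derive1E (@near_eq_derive _ _ _ _ (cst 0)) ?derive_cst//.
by near=> x; apply: phi0; near: x; exact: lt_nbhsr.
Unshelve. all: by end_near. Qed.

End TestFunctions.

(** * The differential equation, the initial and the boundary condition *)

Section Equation.
Context {R : realType} {k : nat} (lam : 'I_k -> R) (b : R).
Hypothesis lam_gt0 : forall j, 0 < lam j.
Hypothesis b_ge0 : 0 <= b.

(** Substitution of [n + i.+1] for [n]; the surplus terms on the right vanish because [G] does from
    [N] on. *)
Lemma sum_shift_index (c G : nat -> R) (N i : nat) :
  (forall n, (N <= n)%N -> G n = 0) ->
  \sum_(n < N | (i < n)%N) c (n - i.+1)%N * G n =
  \sum_(n < N) c n * G (n + i.+1)%N.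
Proof.
move=> G0; have [iN|Ni] := leqP i.+1 N; last first.
  rewrite big1; last by move=> n; have := ltn_ord n; lia.
  by rewrite big1// => n _; rewrite G0 ?mulr0//; lia.
rewrite -(big_mkord xpredT (fun n => c n * G (n + i.+1)%N)).
rewrite (@big_cat_nat _ _ _ (N - i.+1)) ?leq_subr//=.
rewrite [X in _ = _ + X]big1_seq ?addr0; last first.
  move=> n; rewrite mem_index_iota => /andP[_ /andP[Nn _]].
  by rewrite G0 ?mulr0//; lia.
rewrite -(big_mkord (fun n => i < n)%N (fun n => c (n - i.+1)%N * G n)).
rewrite (@big_cat_nat _ _ _ i.+1)//= big1_seq ?add0r; last first.
  by move=> n /andP[ni]; rewrite mem_index_iota => /andP[_]; lia.
rewrite big_nat_cond [RHS]big_nat_cond.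
rewrite -{1}[i.+1]add0n big_addn; apply: eq_big => n; first by lia.
by rewrite addnK.
Qed.

Let u (t : R) := gf_of (gcp_law lam b t).

Lemma solves_gcp_law : solves_drifted_gcp_equation lam b u.
Proof.
move=> t t0.
have dU phi (tphi : test_function phi) (N : nat)
    (phiN : forall y, N%:R <= y -> phi y = 0) :
  is_derive t (1 : R) (fun s => u s phi) (\sum_(n < N)
    (gcp_coef lam n t * (derive1 phi (n%:R + b * t) * b) +
    phi (n%:R + b * t) * (- total_rate lam * gcp_coef lam n t +
      \sum_(i < k | (i < n)%N) lam i * gcp_coef lam (n - i.+1) t))).
  apply: (@near_eq_is_derive _ _ _
    (\sum_(n < N) (gcp_coef lam n * (fun s => phi (n%:R + b * s))))).
    (* The finite-sum formula is available for [s >= 0], hence near [t > 0], with one [N] for all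
       such [s]. *)
    near=> s; have s0 : 0 <= s.
      by apply: ltW; near: s; exact: lt_nbhsr.
    rewrite /u (gf_of_gcp_law lam_gt0 s0 b_ge0 _ phiN) ?fct_sumE//.
    exact: (continuous_measurable_fun (test_function_continuous tphi)).
  apply: is_derive_sum => n.
  have dl : is_derive t (1 : R) (fun s : R => n%:R + b * s) b.
    have h := is_deriveD (is_derive_cst (n%:R : R) t (1 : R)) (is_deriveZ b
      (is_derive_id t (1 : R))).
    by apply: (is_derive_eq h); rewrite /GRing.scale /= mulr1 add0r.
  have dphi := @is_derive1_comp _ phi (fun s : R => n%:R + b * s) t _ _
    (test_function_is_derive (n%:R + b * t) tphi) dl.
  exact: is_deriveM (is_derive_gcp_coef lam n t) dphi.
split=> [phi tphi|phi tphi].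
  have [N phiN] := test_function_eventually0 tphi.
  by have [] := dU phi tphi N (fun y Ny => (phiN y Ny).1).
have [N phiN] := test_function_eventually0 tphi.
have phi0 y : N%:R <= y -> phi y = 0 by move=> /phiN[].
have dphi0 y : N%:R <= y -> derive1 phi y = 0 by move=> /phiN[].
have mphi := continuous_measurable_fun (test_function_continuous tphi).
rewrite /gf_dt derive1E (@derive_val _ _ _ _ _ _ _ (dU phi tphi N phi0)).
rewrite /gf_dy /gf_shift /u.
rewrite !(gf_of_gcp_law lam_gt0 (ltW t0) b_ge0 _ phi0)//.
rewrite !(gf_of_gcp_law lam_gt0 (ltW t0) b_ge0 _ dphi0); last first.
  exact: (continuous_measurable_fun (test_function_continuous_derive1 tphi)).
(* The chain-rule terms due to the moving atoms cancel against [b] times the derivative in [y]. *)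
rewrite big_split /= mulrN mulr_sumr addrAC.
rewrite [X in X - _](_ : _ = \sum_(i < N) b * (gcp_coef lam i t * derive1 phi
  (i%:R + b * t))); last first.
  by apply: eq_bigr => n _; ring.
rewrite subrr add0r.
under eq_bigr do rewrite mulrDr.
rewrite big_split /=; congr (_ + _).
  by rewrite mulr_sumr; apply: eq_bigr => n _; ring.
under eq_bigr do rewrite mulr_sumr.
rewrite (exchange_big_dep xpredT)//=; apply: eq_bigr => i _.
rewrite (gf_of_gcp_law lam_gt0 (ltW t0) b_ge0 (N := N)).
(* At atom [n] the shifted test function equals [G (n + i.+1)]; reindexing yields the recursion of
   the coefficients. *)
- pose G n := phi (n%:R + b * t).
  have GN n : (N <= n)%N -> G n = 0.
    move=> Nn; apply: phi0; rewrite -[leLHS]addr0 lerD ?ler_nat// mulr_ge0//.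
    exact: ltW.
  under [in RHS]eq_bigr do rewrite addrAC -natrD -/(G _).
  rewrite -(sum_shift_index (gcp_coef lam ^~ t) _ GN) mulr_sumr.
  by apply: eq_bigr => n _; rewrite /G; ring.
- apply: measurableT_comp mphi _.
  exact: measurable_funD.
- by move=> y Ny; rewrite phi0// (le_trans Ny)// lerDl.
Unshelve. all: by end_near. Qed.

Lemma gf_of_dirac (a : R) (phi : R -> R) : measurable_fun setT phi ->
  gf_of \d_a phi = phi a.
Proof.
move=> mphi; rewrite /gf_of integral_dirac//; last exact/measurable_EFinP.
by rewrite diracT mul1e.
Qed.

Lemma gcp_law_at0 (A : set R) : gcp_law lam b 0 A = \d_(0 : R) A.
Proof.
rewrite gcp_lawE (@eseries_finite _ _ 1%N); last first.
  by case=> // n _; rewrite gcp_coefn0 mul0e.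
by rewrite big_ord_recl big_ord0 adde0 gcp_coefn0 mul1e mulr0 addr0.
Qed.

Lemma cvg_gcp_law0 phi : test_function phi ->
  u t phi @[t --> 0^'+] --> gf_of \d_(0 : R) phi.
Proof.
move=> tphi; have cphi := test_function_continuous tphi.
have mphi := continuous_measurable_fun cphi.
have [N phiN] := test_function_eventually0 tphi.
(* [N.+1] guarantees that the sum contains the term [n = 0], the only one surviving at time 0. *)
have phi0 y : N.+1%:R <= y -> phi y = 0.
  by move=> Ny; have [] := phiN y (le_trans _ Ny); rewrite ?ler_nat.
have -> : gf_of \d_(0 : R) phi =
    \sum_(n < N.+1) gcp_coef lam n 0 * phi (n%:R + b * 0).
  rewrite gf_of_dirac// big_ord_recl big1 ?addr0.
    by rewrite gcp_coefn0 mul1r mulr0 addr0.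
  by move=> i _; rewrite gcp_coefn0 mul0r.
have : \sum_(n < N.+1) gcp_coef lam n t * phi (n%:R + b * t) @[t --> 0^'+]
    --> \sum_(n < N.+1) gcp_coef lam n 0 * phi (n%:R + b * 0).
  apply: cvg_sum_ord => n; apply: cvgM.
    have [? _] := is_derive_gcp_coef lam n 0.
    exact/cvg_at_right_filter/differentiable_continuous/derivable1_diffP.
  apply: (@cvg_at_right_filter _ _ (fun t : R => phi (n%:R + b * t))).
  apply: (@continuous_comp _ _ _ (fun t : R => n%:R + b * t)); last exact: cphi.
  by apply: cvgD; [exact: cvg_cst|exact: mulrl_continuous].
apply: cvg_trans; apply: near_eq_cvg; near=> t.
by rewrite /u (gf_of_gcp_law lam_gt0 _ b_ge0 mphi phi0).
Unshelve. all: by end_near. Qed.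

(** The kernel at scale [e] vanishes beyond [N * e], while the atoms with [n >= 1] stay at or beyond
    1 for every [t >= 0]. So [N * e < 1] removes them uniformly in [t]. *)
Lemma boundary_gcp_law : boundary_value (total_rate lam) b u.
Proof.
move=> eta [teta even_eta _].
have [N etaN] := test_function_eventually0 teta.
have meta := continuous_measurable_fun (test_function_continuous teta).
near=> e => t t0.
have e0 : 0 < e by [].
have Ne : N%:R * e < 1.
  have : e < N.+1%:R^-1 by near: e; apply: nbhs_right_lt; rewrite invr_gt0.
  rewrite -[X in _ < X]mul1r ltr_pdivlMr// -natr1 mulrDr mulr1 mulrC.
  by apply: le_lt_trans; rewrite lerDl ltW.
have mreg (y : R) : measurable_fun setT (fun z : R => e^-1 * eta ((y - z) / e)).
  apply: measurable_funM => //; apply: measurableT_comp meta _.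
  apply: measurable_funM => //; exact: measurable_funB.
rewrite /regularize gf_of_dirac// /u.
rewrite (gf_of_gcp_law lam_gt0 t0 b_ge0 (mreg 0) (N := 1)).
  rewrite big_ord_recl big_ord0 addr0 gcp_coef0n mulrC /=.
  by rewrite !add0r subr0 mulNr even_eta.
move=> z z1; rewrite sub0r mulNr even_eta (etaN _ _).1 ?mulr0//.
by rewrite ler_pdivlMr// (le_trans (ltW Ne)).
Unshelve. all: by end_near. Qed.

End Equation.

(** * The law of the drifted process and its Laplace transform *)

Section DriftedLaw.
Context (d : measure_display) (T : measurableType d) (R : realType).
Variable P : probability T R.
Variables (k : nat) (lam : 'I_k -> R) (b : R) (M : R -> {RV P >-> nat}).
Hypothesis lam_gt0 : forall j, 0 < lam j.
Hypothesis b_ge0 : 0 <= b.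
Hypothesis gcpM : generalized_counting_process lam M.

(** On [M t = n] the drifted process is the constant [n%:R + b * t], so each piece [F n] is the
    whole event or empty. *)
Lemma distribution_drifted (t : R) (A : set R) : 0 <= t -> measurable A ->
  distribution P (drifted M b t) A = gcp_law lam b t A.
Proof.
move=> t0 mA; rewrite gcp_lawE.
pose F n := [set w | M t w = n] `&` drifted M b t @^-1` A.
have FE n : F n = if n%:R + b * t \in A then [set w | M t w = n] else set0.
  case: ifPn => [/set_mem An|/negP nA]; apply/seteqP; split => w //=.
  - by case.
  - by move=> Mn; split=> //; rewrite /drifted /= Mn.
  - by case=> Mn; rewrite /drifted /= Mn => /mem_set.
have -> : distribution P (drifted M b t) A = P (\bigcup_n F n).
  rewrite /distribution /pushforward; congr (P _); apply/seteqP; split => w /=.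
    by move=> Aw; exists (M t w).
  by case=> n _ [].
have mF n : measurable (F n) by rewrite FE; case: ifP => _ //;
  exact: measurable_RV_eq.
rewrite measure_semi_bigcup//; last 2 first.
- by move=> m n _ _ [w [[/= <- _] [/= <- _]]].
- exact: bigcup_measurable.
apply: eq_eseriesr => n _; rewrite FE diracE; case: ifP => _.
  by rewrite mule1; have := count_probE M n t;
    rewrite (count_prob_gcp_coef gcpM).
by rewrite measure0 mule0.
Qed.

(** A change of variables along the distribution; the drifted process is nonnegative, so restricting
    the integral to the half-line loses nothing. *)
Lemma laplace_drifted (t s : R) : 0 <= t ->
  ('E_P[fun w => expR (- (s * drifted M b t w))])%E =
  (\int[gcp_law lam b t]_(y in `[0%R, +oo[) (expR (- (s * y)))%:E)%E.
Proof.
move=> t0; rewrite (gcp_law_measure b lam_gt0 t0).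
rewrite (eq_measure_integral (distribution P (drifted M b t))); last first.
  move=> A mA _; apply: etrans (esym (distribution_drifted t0 mA)).
  by rewrite (gcp_law_measure b lam_gt0 t0).
rewrite integral_mkcond ge0_integral_distribution; last 2 first.
- apply/(measurable_restrictT _ _).1 => //.
  apply: measurable_funTS; apply/measurable_EFinP.
  by apply: measurableT_comp => //; apply: measurableT_comp.
- by move=> y; rewrite /patch; case: ifP => // _; rewrite lee_fin expR_ge0.
rewrite unlock; apply: eq_integral => w _ /=.
by rewrite patchE mem_set//= in_itv /= andbT addr_ge0// mulr_ge0.
Qed.

Lemma gcp_law_left (t : R) : gcp_law lam b t [set y | y < b * t] = 0%E.
Proof.
rewrite gcp_lawE (@eseries_finite _ _ 0%N) ?big_ord0// => n _.
rewrite diracE memNset ?mule0//= => /lt_geF.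
by rewrite lerDr ler0n.
Qed.

End DriftedLaw.

Unset Implicit Arguments.

Theorem theorem3p1 (R : realType) (d : measure_display) (T : measurableType d)
    (P : probability T R) (k : nat) (lam : 'I_k -> R) (b : R)
    (M : R -> {RV P >-> nat}) :
  (1 <= k)%N -> (forall j, 0 < lam j) -> 0 <= b ->
  generalized_counting_process lam M ->
  let p := gcp_law lam b in
  let u := fun t : R => gf_of (p t) in
  [/\ forall t : R, 0 < t ->
        [/\ forall A : set R, measurable A ->
              distribution P (drifted M b t) A = p t A,
            forall s : R, 0 < s ->
              ('E_P[fun w => expR (- (s * drifted M b t w))])%E =
              (\int[p t]_(y in `[0%R, +oo[) (expR (- (s * y)))%:E)%E &
            p t [set y | y < b * t] = 0%E],
      solves_drifted_gcp_equation lam b u,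
      (forall A : set R, measurable A -> p 0 A = \d_(0 : R) A) /\
      (forall phi, test_function phi ->
         u t phi @[t --> 0^'+] --> gf_of \d_(0 : R) phi) &
      boundary_value (total_rate lam) b u].
Proof.
move=> _ lam0 b0 gcpM p u; split.
- move=> t t0; split.
  + by move=> A; apply: distribution_drifted => //; exact: ltW.
  + by move=> s _; apply: laplace_drifted => //; exact: ltW.
  + exact: gcp_law_left.
- exact: solves_gcp_law.
- by split=> [A _|phi]; [exact: gcp_law_at0|exact: cvg_gcp_law0].
- exact: boundary_gcp_law.
Qed.
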